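(* For an ideal $I$ of $F$, let $J(I)=\langle \bar\iota(I^* )\rangle_{\mathbb N}\subset\bar P$ be its extended letterplace analogue. Then the map $I\mapsto J(I)$ is a bijection from the set of all (two-sided) ideals of $F$ onto the set of all $L$-saturated letterplace ideals of $\bar P$.
   Context: $K$ is a field, $X=\{x_1,x_2,\ldots\}$ is a finite or countable set of variables, $F=K\langle X\rangle$ is the free associative algebra, $t$ is a new variable, $\bar X=X\cup\{t\}$ and $\bar F=K\langle\bar X\rangle$. Ideals of $F,\bar F$ are two-sided, and both algebras are graded by total degree (every variable, including $t$, has degree 1). Let $\varphi:\bar F\to\bar F$ be the algebra endomorphism with $x_i\mapsto x_i$, $t\mapsto 1$, so $\varphi(\bar F)=F$. For an ideal $I\subset F$, the homogenization $I^*\subset\bar F$ is the largest graded ideal contained in $\varphi^{-1}(I)$, i.e. the ideal generated by all homogeneous elements of $\varphi^{-1}(I)$. $\mathbb N=\{0,1,2,\ldots\}$, $\mathbb N^*=\mathbb N\setminus\{0\}$. $\bar P=K[\bar X\times\mathbb N^*]$ is the commutative polynomial algebra in the variables $x_i(j)=(x_i,j)$ and $t(j)=(t,j)$, $j\ge1$. The monoid $(\mathbb N,+)$ acts on $\bar P$ by algebra endomorphisms $f\mapsto k\cdot f$ with $k\cdot x_i(j)=x_i(k+j)$, $k\cdot t(j)=t(k+j)$. An ideal $J$ is an $\mathbb N$-ideal if $k\cdot f\in J$ for all $f\in J,k\in\mathbb N$; $\langle S\rangle_{\mathbb N}$ denotes the smallest $\mathbb N$-ideal containing $S$. $\bar\iota:\bar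 F\to\bar P$ is the $K$-linear embedding with $y_1y_2\cdots y_d\mapsto y_1(1)y_2(2)\cdots y_d(d)$ for $y_1,\ldots,y_d\in\bar X$. Let $\bar V_d$ be the image under $\bar\iota$ of the space of homogeneous elements of degree $d$, and $\bar L=\bigcup_d\bar V_d$ (the multilinear elements). A letterplace ideal (or $L$-ideal) of $\bar P$ is an $\mathbb N$-ideal $J$ with $J=\langle J\cap\bar L\rangle_{\mathbb N}$. Let $D\subset\bar P$ be the $\mathbb N$-ideal generated by the elements $x_i(1)t(2)-t(1)x_i(2)$, $i\ge1$. An $L$-ideal $J$ containing $D$ is called $L$-saturated if, whenever $f\in\bar L$ with $d=\deg(f)$ satisfies $t(d+1)f\in J$, then $f\in J$. *)

(* Defs.v *)
From HB Require Import structures.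
From mathcomp Require Import all_boot all_algebra.
From mathcomp Require Import finmap.
From mathcomp.classical Require Import classical_sets.
From mathcomp.multinomials Require Import monalg.

Set Implicit Arguments.
Unset Strict Implicit.
Unset Printing Implicit Defensive.

Import GRing.Theory.

Local Open Scope classical_set_scope.
Local Open Scope ring_scope.

Section Ideals.
Context (R : pzRingType).

(* Two-sided; closure under opposites follows from multiplication by -1. *)
Definition is_ideal (I : set R) : Prop :=
  [/\ I 0,
      forall f g, I f -> I g -> I (f + g),
      forall f g, I g -> I (f * g) &
      forall f g, I f -> I (f * g)].

End Ideals.

(* The free associative algebra K<A>, as the monoid algebra of the words on A. *)
Notation freeAlg K A := {malg K[{fmonom A}]}.

Section FreeAlgebra.
Context (K : fieldType).

Definition gen (A : choiceType) (a : A) : freeAlg K A := << fmu a >>.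

(* The algebra morphism sending each generator a to h a. *)
Definition subst (A B : choiceType) (h : A -> freeAlg K B) (f : freeAlg K A) :
    freeAlg K B :=
  mmap (@malgC {fmonom B} K) (fun w : {fmonom A} => \prod_(a <- w) h a) f.

(* 0 is homogeneous of every degree. *)
Definition homogeneous (A : choiceType) (d : nat) (f : freeAlg K A) : Prop :=
  forall w, w \in msupp f -> fdeg w = d.

End FreeAlgebra.

(* The index set of the places is {1, 2, 3, ...}; [posnS j] is j + 1. *)
Notation posn := {j : nat | (0 < j)%N}.

Definition posnS (j : nat) : posn := exist _ j.+1 isT.

Definition posn_add (k : nat) (j : posn) : posn :=
  exist _ (k + sval j)%N (ltn_addl k (svalP j)).

Section Letterplace.
Context (K : fieldType) (X : countType).

(* X with the extra variable t adjoined; t is [None]. *)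
Notation Xbar := (option X).
Notation F := (freeAlg K X).
Notation Fbar := (freeAlg K Xbar).
Notation Var := (Xbar * posn)%type.
Notation Pbar := {malg K[{cmonom Var}]}.

(* F is not literally contained in Fbar: [incl] is the inclusion. *)
Definition incl : F -> Fbar := subst (fun x => gen K (Some x)).

(* x_i |-> x_i, t |-> 1 *)
Definition phi : Fbar -> Fbar :=
  subst (fun y => if y is Some _ then gen K y else 1).

(* The preimage under [phi] of an ideal I of F, seen inside Fbar, is
   [phi @^-1` (incl @` I)]; I^* is the ideal of Fbar generated by its
   homogeneous elements. *)
Definition homogenization (I : set F) : set Fbar :=
  smallest (@is_ideal Fbar)
    [set f | (exists d, homogeneous d f) /\ (phi @^-1` (incl @` I)) f].

(* The variable y(j) of the commutative polynomial algebra Pbar. *)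
Definition letter (y : Xbar) (j : posn) : Pbar := << ucm (y, j) >>.

(* The action of k on Pbar: the algebra endomorphism y(j) |-> y(k + j). *)
Definition shift (k : nat) (f : Pbar) : Pbar :=
  mmap (@malgC {cmonom Var} K)
    (fun m : {cmonom Var} =>
      \prod_(v <- finsupp m) letter v.1 (posn_add k v.2) ^+ m v) f.

Definition is_Nideal (J : set Pbar) : Prop :=
  is_ideal J /\ forall k f, J f -> J (shift k f).

Definition Nideal_gen (S : set Pbar) : set Pbar := smallest is_Nideal S.

(* The K-linear map y_1 y_2 ... y_d |-> y_1(1) y_2(2) ... y_d(d); the default
   value of [nth] is never reached. *)
Definition iotabar (f : Fbar) : Pbar :=
  \sum_(w <- msupp f)
    f@_w *: \prod_(i < size w) letter (nth None w i) (posnS i).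

Definition Vbar (d : nat) : set Pbar := iotabar @` homogeneous d.

Definition Lbar : set Pbar := \bigcup_d Vbar d.

Definition is_Lideal (J : set Pbar) : Prop :=
  is_Nideal J /\ J = Nideal_gen (J `&` Lbar).

(* Generated by the x_i(1) t(2) - t(1) x_i(2). *)
Definition Dideal : set Pbar :=
  Nideal_gen (range (fun x : X =>
    letter (Some x) (posnS 0) * letter None (posnS 1)
    - letter None (posnS 0) * letter (Some x) (posnS 1))).

(* The total degree, as [msize f] is one more than it; [tdeg 0 = 0], which is
   immaterial below since 0 lies in every ideal. *)
Definition tdeg (f : Pbar) : nat := (msize f).-1.

(* The place d + 1, with d = deg f, is [posnS (tdeg f)]. *)
Definition is_Lsaturated (J : set Pbar) : Prop :=
  [/\ is_Lideal J,
      Dideal `<=` J &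
      forall f, Lbar f -> J (letter None (posnS (tdeg f)) * f) -> J f].

Definition letterplace (I : set F) : set Pbar :=
  Nideal_gen (iotabar @` homogenization I).

End Letterplace.

(* Main.v *)
From HB Require Import structures.
From mathcomp Require Import all_boot all_algebra.
From mathcomp Require Import finmap.
From mathcomp.classical Require Import boolp classical_sets functions.
From mathcomp.multinomials Require Import monalg.
Require Import Defs.

Set Implicit Arguments.
Unset Strict Implicit.
Unset Printing Implicit Defensive.

Import GRing.Theory.

Local Open Scope ring_scope.
Local Notation "1" := (@mone _) : monom_scope.
Local Notation "x * y" := (mmul x y) : monom_scope.

(** Write T for the new variable and [dehom] for the morphism from Fbar to F
    that deletes T.  The correspondence splits in two.

    Graded ideals S of Fbar embed into N-ideals of Pbar by sending S to the
    N-ideal generated by iotabar(S), because S can be read off again: a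
    product of a monomial m with a shifted image k . iotabar(w) of a nonempty
    word w is again the image of a word only when m supplies exactly the
    k letters in front of w and a block of letters behind it.  So, if
    [project] is the linear retraction of iotabar that kills all other
    monomials, then project(m (k . iotabar(g))) is 0 or u g v with words u and
    v, for every homogeneous g.  Hence [project] maps the N-ideal
    generated by iotabar(S) into S ([contextual_iotabar], [Nideal_iotabar]).

    Ideals I of F correspond to those graded ideals S that contain the
    commutators [x, T] and are saturated with respect to T.  Indeed I^* is the
    set of the elements all of whose homogeneous components have their
    dehomogenization in I ([homogenizationE]), and I is the image of I^* under
    dehom ([dehom_homogenization]), whence injectivity.  Conversely, given S,
    modulo the commutators a homogeneous f of degree N is determined by
    dehom f: every T can be moved to the right, where the exponent is forced by
    N ([homogenize_dehom]).  If dehom f = dehom h with h in S, pad f and the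
    components of h with powers of T to a common degree; then the padded f is
    congruent to the sum of the padded components, so S contains some f T^k,
    and f by saturation ([dehom_preimage_eq]).  So S is the homogenization of
    dehom(S).

    On the letterplace side the commutators become the generators of D, and
    multiplication by T on the right becomes multiplication by t(d + 1)
    ([iotabarMT]), so both conditions on S are those in the definition of an
    L-saturated ideal. *)

(** * Linear maps and ideals of monoid algebras *)

Section Malg.
Context (K : fieldType).

Lemma malg_ind (M : choiceType) (P : {malg K[M]} -> Prop) :
    P 0 -> (forall f g, P f -> P g -> P (f + g)) ->
    (forall c m, P << c *g m >>) ->
  forall f, P f.
Proof.
move=> P0 PD PU f; rewrite [f]monalgE.
by apply: big_ind => // m _; apply: PU.
Qed.

Lemma mcoeff_sum (M : choiceType) (I : Type) (r : seq I) (P : pred I)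
    (F : I -> {malg K[M]}) m :
  (\sum_(i <- r | P i) F i)@_m = \sum_(i <- r | P i) (F i)@_m.
Proof. exact: (raddf_sum (mcoeff m)). Qed.

Lemma malgUM (M : monomType) (c d : K) (m n : M) :
  << c *g m >> * << d *g n >> = << c * d *g (m * n)%M >> :> {malg K[M]}.
Proof. by rewrite malgM_def fgmulUU. Qed.

Lemma malgU1M (M : monomType) (m n : M) :
  << m >> * << n >> = << (m * n)%M >> :> {malg K[M]}.
Proof. by rewrite malgUM mulr1. Qed.

Lemma malgZU (M : choiceType) (c : K) (m : M) :
  << c *g m >> = c *: << m >> :> {malg K[M]}.
Proof.
by apply/malgP=> n; rewrite mcoeffZ !mcoeffU mulrnAr mulr1.
Qed.

Lemma comm_malgC (M : monomType) (c : K) (f : {malg K[M]}) : GRing.comm c%:MP f.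
Proof.
rewrite /GRing.comm; elim/malg_ind: f => [|f g Hf Hg|d m].
- by rewrite mulr0 mul0r.
- by rewrite mulrDr mulrDl Hf Hg.
- by rewrite !malgUM mulrC mul1m mulm1.
Qed.

End Malg.

Section LinearExtension.
Context (K : fieldType) (M : choiceType).

Lemma linear_malgE (V : lmodType K) (u : {linear {malg K[M]} -> V}) f :
  u f = \sum_(m <- msupp f) f@_m *: u << m >>.
Proof.
rewrite [in LHS](monalgE f) linear_sum; apply: eq_bigr => m _.
by rewrite malgZU linearZ_LR.
Qed.

Lemma eq_linear_malg (V : lmodType K) (u v : {linear {malg K[M]} -> V}) :
  (forall m, u << m >> = v << m >>) -> u =1 v.
Proof.
by move=> uv f; rewrite !linear_malgE; apply: eq_bigr => m _; rewrite uv.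
Qed.

Context (N : monomType) (b : M -> {malg K[N]}).

(** A constant of its own, rather than [mmap] itself, so as to carry a
    structure of linear map. *)
Definition linext (f : {malg K[M]}) : {malg K[N]} := mmap malgC b f.

Fact linext_is_additive : additive linext.
Proof. exact: mmap_is_additive. Qed.

Fact linext_is_scalable : scalable linext.
Proof.
move=> c f; rewrite /linext (mmapEw (msuppZ_le _ _)) mmapE scaler_sumr.
by apply: eq_bigr => m _; rewrite !mul_malgC mcoeffZ scalerA.
Qed.

HB.instance Definition _ :=
  GRing.isAdditive.Build {malg K[M]} {malg K[N]} linext linext_is_additive.
HB.instance Definition _ :=
  GRing.isScalable.Build K {malg K[M]} {malg K[N]} *:%R
    linext linext_is_scalable.

Lemma linextU m : linext << m >> = b m.
Proof. by rewrite /linext mmapU mul_malgC scale1r. Qed.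

Lemma linextE f : linext f = \sum_(m <- msupp f) f@_m *: b m.
Proof. by rewrite /linext mmapE; apply: eq_bigr => m _; rewrite mul_malgC. Qed.

End LinearExtension.

(** The same conditions as in [is_ideal], with the operations taken in the
    algebra rather than in its underlying abstract ring. *)
Lemma malg_ideal (K : fieldType) (M : monomType) (S : set {malg K[M]}) :
    S 0 -> (forall f g, S f -> S g -> S (f + g)) ->
    (forall f g, S g -> S (f * g)) -> (forall f g, S f -> S (f * g)) ->
  is_ideal S.
Proof. by []. Qed.

Section Ideal.
Context (K : fieldType) (M : monomType) (S : set {malg K[M]}).
Context (idS : is_ideal S).

Lemma ideal0 : S 0. Proof. by case: idS. Qed.
Lemma idealD f g : S f -> S g -> S (f + g).
Proof. by case: idS => _ + _ _; apply. Qed.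
Lemma idealMl f g : S g -> S (f * g).
Proof. by case: idS => _ _ + _; apply. Qed.
Lemma idealMr f g : S f -> S (f * g).
Proof. by case: idS => _ _ _; apply. Qed.
Lemma idealN f : S f -> S (- f).
Proof. by move=> Sf; rewrite -mulN1r; apply: idealMl. Qed.
Lemma idealZ c f : S f -> S (c *: f).
Proof. by move=> Sf; rewrite -mul_malgC; apply: idealMl. Qed.
Lemma ideal_sum (I : Type) (r : seq I) (P : pred I) (F : I -> {malg K[M]}) :
  (forall i, P i -> S (F i)) -> S (\sum_(i <- r | P i) F i).
Proof. by move=> SF; apply: big_ind => //; [apply: ideal0|apply: idealD]. Qed.
Lemma ideal_subr f g : S (f - g) -> S g -> S f.
Proof. by move=> Sfg Sg; rewrite -(subrK g f); apply: idealD. Qed.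
End Ideal.

(** * Words and substitutions in free algebras *)

Section Words.
Context (K : fieldType) (A : choiceType).

Definition word (s : seq A) : freeAlg K A := << FMonom s >>.

Lemma word_nil : word [::] = 1.
Proof. by rewrite /word -fmoneE. Qed.

Lemma word_cat s1 s2 : word (s1 ++ s2) = word s1 * word s2.
Proof. by rewrite malgU1M /mmul /= fmmulE. Qed.

End Words.

Section Subst.
Context (K : fieldType).

Lemma gen_word (A : choiceType) (a : A) : gen K a = word K [:: a].
Proof. by rewrite /gen fmuE. Qed.

Definition word_eval (A B : choiceType) (h : A -> freeAlg K B)
    (w : {fmonom A}) : freeAlg K B := \prod_(a <- w) h a.

Fact word_eval_mmorph (A B : choiceType) (h : A -> freeAlg K B) :
  mmorphism (word_eval h).
Proof.
by split=> [w1 w2|]; rewrite /word_eval ?fmM ?big_cat // fm1 big_nil.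
Qed.

HB.instance Definition _ (A B : choiceType) (h : A -> freeAlg K B) :=
  isMultiplicative.Build {fmonom A} (freeAlg K B) (word_eval h)
    (word_eval_mmorph h).

Section One.
Context (A B : choiceType) (h : A -> freeAlg K B).

HB.instance Definition _ := GRing.Linear.copy (subst h) (linext (word_eval h)).

(** The target need not be commutative, but scalars are central in it. *)
Fact subst_is_multiplicative : multiplicative (subst h).
Proof.
apply: (@commr_mmap_is_multiplicative _ _ _ malgC (word_eval h)) => g m m'.
exact: comm_malgC.
Qed.

HB.instance Definition _ :=
  GRing.isMultiplicative.Build (freeAlg K A) (freeAlg K B)
    (subst h) subst_is_multiplicative.

Lemma subst_word s : subst h (word K s) = \prod_(a <- s) h a.
Proof. exact: linextU. Qed.

Lemma subst_gen a : subst h (gen K a) = h a.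
Proof. by rewrite gen_word subst_word big_seq1. Qed.

End One.

Lemma word_prod (A : choiceType) (s : seq A) :
  word K s = \prod_(a <- s) gen K a.
Proof.
elim: s => [|a s IH]; first by rewrite big_nil word_nil.
by rewrite big_cons -IH -cat1s word_cat gen_word.
Qed.

Lemma subst_comp (A B C : choiceType) (g : A -> freeAlg K B)
    (h : B -> freeAlg K C) f :
  subst h (subst g f) = subst (fun a => subst h (g a)) f.
Proof.
apply: (eq_linear_malg (u := subst h \o subst g)) => -[s] /=.
by rewrite (subst_word g) subst_word rmorph_prod.
Qed.

Lemma eq_subst (A B : choiceType) (g h : A -> freeAlg K B) :
  g =1 h -> subst g =1 subst h.
Proof. by move=> /funext ->. Qed.

Lemma subst_id (A : choiceType) (f : freeAlg K A) : subst (@gen K A) f = f.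
Proof.
apply: (eq_linear_malg (v := idfun)) => -[s] /=.
by rewrite subst_word -word_prod.
Qed.

End Subst.

(** * Homogeneous components and graded ideals *)

Section Components.
Context (K : fieldType) (A : choiceType).
Implicit Types (f g : freeAlg K A) (d e : nat).

Definition component d : freeAlg K A -> freeAlg K A :=
  linext (fun w => if fdeg w == d then << w >> else 0).

HB.instance Definition _ d := GRing.Linear.on (component d).

Lemma mcoeff_component d f w :
  (component d f)@_w = if fdeg w == d then f@_w else 0.
Proof.
rewrite /component linextE mcoeff_sum.
have [dw|/negPf dw] := eqVneq (fdeg w) d.
  rewrite [f in RHS]monalgE [RHS]mcoeff_sum.
  apply: eq_bigr => v _; rewrite mcoeffZ mcoeffU.
  case: (eqVneq v w) => [->|vw]; first by rewrite dw eqxx mcoeffUU mulr1.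
  by case: ifP => _; rewrite ?mcoeff0 ?mcoeffU ?(negPf vw) mulr0.
apply: big1 => v _; rewrite mcoeffZ.
case: (eqVneq v w) => [->|/negPf vw]; first by rewrite dw mcoeff0 mulr0.
by case: ifP => _; rewrite ?mcoeff0 ?mcoeffU ?vw mulr0.
Qed.

Lemma component_homogeneous d f : homogeneous d (component d f).
Proof.
move=> w; rewrite -mcoeff_neq0 mcoeff_component; case: (fdeg w =P d) => // _.
by rewrite eqxx.
Qed.

Lemma homogeneous_component d e f : homogeneous d f ->
  component e f = if e == d then f else 0.
Proof.
move=> hf; case: eqVneq => [->|/negPf ed]; apply/malgP => w;
  rewrite mcoeff_component.
  case: (fdeg w =P d) => // /eqP/negPf wd; rewrite mcoeff_outdom //.
  by apply/negP => /hf /eqP; rewrite wd.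
rewrite mcoeff0; case: (fdeg w =P e) => // we; rewrite mcoeff_outdom //.
by apply/negP => /hf; rewrite we => /eqP; rewrite ed.
Qed.

Lemma sum_components f N : (forall w, w \in msupp f -> (fdeg w <= N)%N) ->
  f = \sum_(d < N.+1) component d f.
Proof.
move=> degf; apply/malgP => w; rewrite mcoeff_sum.
under eq_bigr do rewrite mcoeff_component.
case: (msuppP f w) => [/degf lew|_]; last first.
  by rewrite big1 // => d _; rewrite if_same.
rewrite (bigD1 (Ordinal (lew : (fdeg w < N.+1)%N))) //= eqxx.
rewrite big1 ?addr0 // => d.
by rewrite -val_eqE /= eq_sym => /negPf ->.
Qed.

Lemma degree_bound f : exists N, forall w, w \in msupp f -> (fdeg w <= N)%N.
Proof.
by exists (mmeasure (@fdeg A) f) => w wf; apply/ltnW/mmeasure_mnm_lt.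
Qed.

Lemma homogeneous0 d : homogeneous d (0 : freeAlg K A).
Proof. by move=> w; rewrite msupp0. Qed.

Lemma homogeneousD d f g :
  homogeneous d f -> homogeneous d g -> homogeneous d (f + g).
Proof.
move=> hf hg w /(fsubsetP (msuppD_le _ _)).
by rewrite in_fsetU => /orP[/hf|/hg].
Qed.

Lemma homogeneousZ d c f : homogeneous d f -> homogeneous d (c *: f).
Proof. by move=> hf w /(fsubsetP (msuppZ_le _ _)) /hf. Qed.

Lemma homogeneousN d f : homogeneous d f -> homogeneous d (- f).
Proof. by move=> hf w; rewrite msuppN => /hf. Qed.

Lemma homogeneous_sum d (I : eqType) (r : seq I) (F : I -> freeAlg K A) :
  (forall i, i \in r -> homogeneous d (F i)) ->
  homogeneous d (\sum_(i <- r) F i).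
Proof.
move=> hF; rewrite big_seq; apply: big_ind => //; first exact: homogeneous0.
by move=> f g; apply: homogeneousD.
Qed.

Lemma homogeneousM d e f g :
  homogeneous d f -> homogeneous e g -> homogeneous (d + e) (f * g).
Proof.
move=> hf hg w /msuppM_le[u [v [/hf <- /hg <- ->]]]; exact: fdegM.
Qed.

Lemma homogeneous_word s : homogeneous (size s) (word K s : freeAlg K A).
Proof. by move=> w; rewrite msuppU1 in_fset1 => /eqP ->. Qed.

Lemma homogeneous_wordE d s :
  size s = d -> homogeneous d (word K s : freeAlg K A).
Proof. by move=> <-; apply: homogeneous_word. Qed.

End Components.
Arguments component_homogeneous {K A} d f.

Section Homogeneously.
Context (K : fieldType) (A : choiceType) (P : set (freeAlg K A)).

(** Both I^* and the graded ideal attached to an L-saturated ideal have this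
    form. *)
Definition homogeneously : set (freeAlg K A) :=
  [set f | forall d, P (component d f)]%classic.

Lemma homogeneously_component d f :
  P 0 -> homogeneously f -> homogeneously (component d f).
Proof.
move=> P0 Pf e; rewrite (homogeneous_component _ (component_homogeneous d f)).
by case: ifP.
Qed.

Lemma homogeneously_homogeneous d f : P 0 -> homogeneous d f ->
  homogeneously f <-> P f.
Proof.
move=> P0 hf; split=> [/(_ d)|Pf e]; rewrite (homogeneous_component _ hf).
  by rewrite eqxx.
by case: ifP.
Qed.

(** Only products of homogeneous elements have to be examined; this matters
    because iotabar(f g) factors through iotabar(f) and iotabar(g) only for
    homogeneous f. *)
Lemma homogeneously_ideal :
    P 0 -> (forall f g, P f -> P g -> P (f + g)) ->
    (forall d e f g, homogeneous d f -> homogeneous e g ->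
       P f -> P (f * g) /\ P (g * f)) ->
  is_ideal homogeneously.
Proof.
move=> P0 PD PM.
have Pmul f g d : (forall i j, P (component i f * component j g)) ->
    P (component d (f * g)).
  move=> Pij; have [N fN] := degree_bound f; have [N' gN] := degree_bound g.
  rewrite (sum_components fN) (sum_components gN) mulr_suml linear_sum /=.
  apply: big_ind => // i _; rewrite mulr_sumr linear_sum /=.
  apply: big_ind => // j _; rewrite (homogeneous_component (d := i + j)).
    by case: ifP.
  by apply: homogeneousM; apply: component_homogeneous.
apply: malg_ideal => [d|f g Pf Pg d|f g Pg d|f g Pf d].
- by rewrite linear0.
- by rewrite linearD; apply: PD; [apply: Pf|apply: Pg].
- apply: Pmul => i j.
  exact: (PM j i _ _ (component_homogeneous j g) (component_homogeneous i f)
    (Pg j)).2.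
- apply: Pmul => i j.
  exact: (PM i j _ _ (component_homogeneous i f) (component_homogeneous j g)
    (Pf i)).1.
Qed.

End Homogeneously.

(** * Homogenization of ideals *)

Section Homogenization.
Context (K : fieldType) (X : countType).
Local Notation F := (freeAlg K X).
Local Notation Fbar := (freeAlg K (option X)).
Local Notation T := (gen K (None : option X)).

Definition dehom : Fbar -> F :=
  subst (fun y => if y is Some x then gen K x else 1).

HB.instance Definition _ := GRing.Linear.on dehom.
HB.instance Definition _ := GRing.RMorphism.on dehom.

Lemma dehom0 : dehom 0 = 0. Proof. exact: linear0. Qed.

Lemma dehomD f g : dehom (f + g) = dehom f + dehom g.
Proof. exact: linearD. Qed.

Lemma dehomB f g : dehom (f - g) = dehom f - dehom g.
Proof. exact: linearB. Qed.

Lemma dehomM f g : dehom (f * g) = dehom f * dehom g.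
Proof. exact: rmorphM. Qed.

Lemma dehom_sum (J : Type) (r : seq J) (P : pred J) (f : J -> Fbar) :
  dehom (\sum_(j <- r | P j) f j) = \sum_(j <- r | P j) dehom (f j).
Proof. exact: linear_sum. Qed.

Lemma dehom_gen y : dehom (gen K y) = if y is Some x then gen K x else 1.
Proof. exact: subst_gen. Qed.

Lemma dehom_word s : dehom (word K s) = word K (pmap id s).
Proof.
rewrite /dehom subst_word; elim: s => [|[x|] s IH] /=.
- by rewrite big_nil word_nil.
- by rewrite big_cons IH -[x :: _]cat1s word_cat gen_word.
- by rewrite big_cons IH mul1r.
Qed.

Lemma inclK : cancel (@incl K X) dehom.
Proof.
move=> f; rewrite /dehom /incl subst_comp -[RHS]subst_id.
by apply: eq_subst => x; rewrite subst_gen.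
Qed.

Lemma phiE f : phi f = incl (dehom f).
Proof.
rewrite /phi /dehom /incl subst_comp; apply: eq_subst => -[x|].
  by rewrite subst_gen.
by rewrite rmorph1.
Qed.

(** [phi] is [dehom] followed by the injective [incl], so that the subalgebra
    of Fbar in the definition of I^* can be replaced by F itself. *)
Lemma phi_preimage (I : set F) f :
  (@phi K X @^-1` (@incl K X @` I))%classic f <-> I (dehom f).
Proof.
rewrite /preimage /= phiE; split=> [[g Ig gf]|If]; last by exists (dehom f).
by rewrite -(inclK (dehom f)) -gf inclK.
Qed.

(** Pads each word with T on the right up to length N; words longer than N are
    left as they are. *)
Definition homogenize (N : nat) : F -> Fbar :=
  linext (fun w : {fmonom X} => word K (map Some w ++ nseq (N - size w) None)).

HB.instance Definition _ N := GRing.Linear.on (homogenize N).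

Lemma homogenize_word N s :
  homogenize N (word K s) = word K (map Some s ++ nseq (N - size s) None).
Proof. exact: linextU. Qed.

Lemma homogenizeK N : cancel (homogenize N) dehom.
Proof.
move=> f; apply: (eq_linear_malg (u := dehom \o homogenize N) (v := idfun)).
move=> [s] /=; rewrite (homogenize_word N s) dehom_word pmap_cat.
rewrite map_pK // (_ : pmap id _ = [::]) ?cats0 //.
by elim: (N - _)%N.
Qed.

Lemma homogenize_homogeneous N f :
  (forall w, w \in msupp f -> (fdeg w <= N)%N) ->
  homogeneous N (homogenize N f).
Proof.
move=> fN; rewrite /homogenize linextE; apply: homogeneous_sum => w /fN wN.
apply: homogeneousZ; apply: homogeneous_wordE.
by rewrite size_cat size_map size_nseq subnKC.
Qed.

Section OneIdeal.
Context (I : set F) (idI : is_ideal I).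

Lemma dehom_preimage_ideal : is_ideal (homogeneously (fun f => I (dehom f))).
Proof.
apply: homogeneously_ideal => [|f g|d e f g _ _ If].
- by rewrite dehom0; exact: (ideal0 idI).
- by rewrite dehomD; exact: (idealD idI).
split; rewrite dehomM.
  exact: (idealMr idI).
exact: (idealMl idI).
Qed.

(** The right-hand side is an ideal and contains the homogeneous generators of
    I^*; conversely its elements are sums of such generators. *)
Lemma homogenizationE : homogenization I = homogeneously (fun f => I (dehom f)).
Proof.
have I0 : I (dehom 0) by rewrite dehom0; exact: (ideal0 idI).
apply/seteqP; split; last first.
  move=> f If J [idJ genJ]; have [N fN] := degree_bound f.
  rewrite (sum_components fN); apply: (ideal_sum idJ) => // d _.
  apply: genJ; split.
    by exists d; apply: component_homogeneous.
  exact/phi_preimage/If.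
apply: smallest_sub => [|f [[d hf] /phi_preimage If]].
  exact: dehom_preimage_ideal.
exact/(homogeneously_homogeneous I0 hf).
Qed.

(** An element of I is recovered from its homogenization in any degree that
    bounds the lengths of its words. *)
Lemma dehom_homogenization : (dehom @` homogenization I)%classic = I.
Proof.
have I0 : I (dehom 0) by rewrite dehom0; exact: (ideal0 idI).
rewrite homogenizationE; apply/seteqP; split=> [_ [f If <-]|f If].
  have [N fN] := degree_bound f.
  rewrite (sum_components fN) dehom_sum; apply: (ideal_sum idI) => d _.
  exact: (If d).
have [N fN] := degree_bound f; exists (homogenize N f); last exact: homogenizeK.
apply/(homogeneously_homogeneous I0 (homogenize_homogeneous fN)).
by rewrite homogenizeK.
Qed.

End OneIdeal.
End Homogenization.

(** * Words as multilinear monomials *)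

Section Places.
Context (K : fieldType) (X : countType).
Local Notation Xbar := (option X).
Local Notation Fbar := (freeAlg K Xbar).
Local Notation Var := (Xbar * posn)%type.
Local Notation Mon := {cmonom Var}.
Local Notation Pbar := {malg K[Mon]}.

(** The monomial y_1(k+1) ... y_d(k+d) of the word y_1 ... y_d. *)
Fixpoint placed (k : nat) (s : seq Xbar) : Mon :=
  if s is y :: s' then (ucm (y, posnS k) * placed k.+1 s')%M else 1%M.

Lemma placed_cat k s1 s2 :
  placed k (s1 ++ s2) = (placed k s1 * placed (k + size s1) s2)%M.
Proof.
elim: s1 k => [|y s1 IH] k /=; first by rewrite addn0 mul1m.
by rewrite IH mulmA addSnnS.
Qed.

Lemma mdeg_placed k s : mdeg (placed k s) = size s.
Proof.
by elim: s k => [|y s IH] k /=; rewrite ?mdeg1 // mdegM mdegU IH.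
Qed.

Lemma eq_posnS i j : (posnS i == posnS j) = (i == j).
Proof. by []. Qed.

Lemma placed_before k s y j : (j < k)%N -> placed k s (y, posnS j) = 0%N.
Proof.
elim: s k => [|z s IH] k jk /=; first by rewrite cm1.
by rewrite cmM cmU (IH k.+1 (leqW jk)) xpair_eqE eq_posnS (gtn_eqF jk) andbF.
Qed.

(** The exponents of [placed k s] determine the letters of s; this gives both
    injectivity and the factorization below. *)
Lemma placed_at k s y i :
  placed k s (y, posnS (k + i)) = (i < size s)%N && (nth None s i == y) :> nat.
Proof.
elim: s k i => [|z s IH] k [|i] /=; rewrite ?cm1 // cmM cmU xpair_eqE eq_posnS.
  by rewrite addn0 eqxx andbT placed_before ?addn0.
by rewrite -{1}[k]addn0 eqn_add2l andbF add0n addnS -addSn IH.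
Qed.

Lemma placed_inj : injective (placed 0).
Proof.
move=> s1 s2 s12; have sz : size s1 = size s2.
  by rewrite -(mdeg_placed 0) s12 mdeg_placed.
apply: (eq_from_nth (x0 := None)) => // i i1.
have := placed_at 0 s2 (nth None s1 i) i.
by rewrite -s12 placed_at eqxx i1 -sz i1 /=; case: eqP.
Qed.

Lemma mulcmI (m : Mon) : injective (mmul m).
Proof.
move=> m1 m2 /eqP/cmP m12; apply/eqP/cmP => v; have := m12 v.
by rewrite !cmM => /addnI.
Qed.

(** If m completes w, placed from k + 1 on, to the image of a word z, then z
    reads w at these places, and cancellation leaves in m the prefix u and the
    suffix v of z.  Hence m completes every w' of the same length, with the same
    u and v.  If w is empty, then z may have fewer than k letters; m is then the
    image of z itself. *)
Lemma placed_factor m k w z : (m * placed k w = placed 0 z)%M ->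
  exists u v, forall w', size w' = size w ->
    (m * placed k w' = placed 0 (u ++ w' ++ v))%M.
Proof.
case: w => [|a w] mz.
  exists z, [::] => w' /size0nil ->; rewrite /= !cats0; exact: mz.
set w0 := a :: w in mz *.
have zw i : (i < size w0)%N ->
    (k + i < size z)%N /\ nth None z (k + i) = nth None w0 i.
  move=> iw; have := placed_at 0 z (nth None w0 i) (k + i).
  rewrite -mz cmM !add0n placed_at iw eqxx addn1.
  by case: ltnP => // _; case: eqP.
have kz : (k + size w0 <= size z)%N.
  by have [] := zw (size w) (leqnn _); rewrite -addnS.
have kz' : (k <= size z)%N := leq_trans (leq_addr _ _) kz.
have zE : z = take k z ++ w0 ++ drop (k + size w0) z.
  rewrite -{1}(cat_take_drop k z); congr (_ ++ _).
  rewrite -(cat_take_drop (size w0) (drop k z)) drop_drop addnC; congr (_ ++ _).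
  have st : size (take (size w0) (drop k z)) = size w0.
    by rewrite size_takel // size_drop leq_subRL.
  apply: (eq_from_nth (x0 := None)) => //; rewrite st => i iw.
  by rewrite nth_take // nth_drop; case: (zw i iw).
have sk : size (take k z) = k by rewrite size_takel.
exists (take k z), (drop (k + size w0) z) => w' sw.
have mE : (m = placed 0 (take k z) *
               placed (k + size w0) (drop (k + size w0) z))%M.
  apply: (@mulcmI (placed k w0)); rewrite mulmC mz {1}zE !placed_cat sk !add0n.
  by rewrite mulmA [in RHS]mulmA [(placed k w0 * _)%M]mulmC.
rewrite mE !placed_cat sk sw !add0n -!mulmA; congr mmul.
exact: mulmC.
Qed.

Definition shift_mon k (m : Mon) : Pbar :=
  \prod_(v <- finsupp m) @letter K X v.1 (posn_add k v.2) ^+ m v.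

(** Enlarging the index set makes the products for m, n and m n comparable. *)
Lemma shift_mon_sub k (m : Mon) (D : {fset Var}) : (finsupp m `<=` D)%fset ->
  shift_mon k m = \prod_(v <- D) @letter K X v.1 (posn_add k v.2) ^+ m v.
Proof.
move=> mD; rewrite /shift_mon (big_fset_incl _ mD) // => v _.
by rewrite -cmE_eq0 => /eqP ->; rewrite expr0.
Qed.

Fact shift_mon_mmorph k : mmorphism (shift_mon k).
Proof.
split=> [m n|]; last by rewrite /shift_mon mdom1 big_seq_fset0.
rewrite (shift_mon_sub k (fsubsetUl (finsupp m) (finsupp n))).
rewrite (shift_mon_sub k (fsubsetUr (finsupp m) (finsupp n))).
rewrite /shift_mon mdomD -big_split; apply: eq_bigr => v _ /=.
by rewrite cmM exprD.
Qed.

HB.instance Definition _ k :=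
  isMultiplicative.Build Mon Pbar (shift_mon k) (shift_mon_mmorph k).

HB.instance Definition _ k :=
  GRing.Linear.copy (@shift K X k) (linext (shift_mon k)).

Fact shift_is_multiplicative k : multiplicative (@shift K X k).
Proof. exact: (mmap_is_multiplicative (f := malgC) (h := shift_mon k)). Qed.

HB.instance Definition _ k :=
  GRing.isMultiplicative.Build Pbar Pbar (@shift K X k)
    (shift_is_multiplicative k).

Lemma shiftU k m : @shift K X k << m >> = shift_mon k m.
Proof. exact: linextU. Qed.

Lemma shiftM k (f g : Pbar) : shift k (f * g) = shift k f * shift k g.
Proof. exact: rmorphM. Qed.

Lemma shift_letter k y j :
  shift k (@letter K X y j) = @letter K X y (posn_add k j).
Proof.
by rewrite shiftU /shift_mon mdomU big_seq_fset1 cmUU expr1.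
Qed.

Lemma shift_shift k l (f : Pbar) : shift k (shift l f) = shift (k + l) f.
Proof.
apply: (eq_linear_malg (u := @shift K X k \o @shift K X l)) => m /=.
rewrite !shiftU /shift_mon rmorph_prod; apply: eq_bigr => v _.
have addkl : posn_add k (posn_add l v.2) = posn_add (k + l) v.2.
  by apply: val_inj; rewrite /= addnA.
have vkl := shift_letter k v.1 (posn_add l v.2); rewrite addkl in vkl.
apply: etrans (rmorphXn (@shift K X k) (m v) (letter K v.1 (posn_add l v.2))) _.
by rewrite [X in X ^+ _]vkl.
Qed.

Lemma letters_placed k s :
  \prod_(i < size s) @letter K X (nth None s i) (posnS (k + i)) =
  << placed k s >>.
Proof.
elim: s k => [|y s IH] k /=; first by rewrite big_ord0.
rewrite big_ord_recl -malgU1M -IH /= addn0.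
have tailE : \prod_(i < size s)
      @letter K X (nth None (y :: s) (lift ord0 i)) (posnS (k + lift ord0 i)) =
    \prod_(i < size s) @letter K X (nth None s i) (posnS (k.+1 + i)).
  by apply: eq_bigr => i _; rewrite lift0 addSnnS.
exact: (congr1 (GRing.mul (@letter K X y (posnS k))) tailE).
Qed.

Lemma shift_placed k j s :
  @shift K X k << placed j s >> = << placed (k + j) s >>.
Proof.
rewrite -!letters_placed rmorph_prod; apply: eq_bigr => i _ /=.
rewrite shift_letter; congr letter.
by apply: val_inj; rewrite /= addnS addnA.
Qed.

Lemma iotabar_linext :
  @iotabar K X = linext (fun w : {fmonom Xbar} => << placed 0 w >>).
Proof.
apply: funext => f; rewrite linextE; apply: eq_bigr => w _.
by rewrite -letters_placed.
Qed.

Fact iotabar_is_linear : linear (@iotabar K X).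
Proof. by rewrite iotabar_linext; exact: linearP. Qed.

HB.instance Definition _ :=
  GRing.isLinear.Build K Fbar Pbar *:%R (@iotabar K X) iotabar_is_linear.

Lemma iotabarB (f g : Fbar) : iotabar (f - g) = iotabar f - iotabar g.
Proof. exact: linearB. Qed.

Lemma iotabar_word s : iotabar (word K s) = << placed 0 s >>.
Proof. by rewrite iotabar_linext linextU. Qed.

(** The inverse of [placed 0] on its image, and 0 elsewhere; [project] extends
    it to a linear retraction of [iotabar]. *)
Definition unplace (m : Mon) : Fbar :=
  if pselect (exists s, placed 0 s = m) is left ex then word K (projT1 (cid ex))
  else 0.

Definition project : Pbar -> Fbar := linext unplace.

HB.instance Definition _ := GRing.Linear.on project.

Lemma project_placed s : project << placed 0 s >> = word K s.
Proof.
rewrite /project linextU /unplace; case: pselect => [ex|[]]; last by exists s.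
by case: (cid ex) => /= s' /placed_inj ->.
Qed.

Lemma project_other m : (forall s, placed 0 s <> m) -> project << m >> = 0.
Proof.
by rewrite /project linextU /unplace; case: pselect => // -[s sm] /(_ s).
Qed.

Lemma iotabarK : cancel (@iotabar K X) project.
Proof.
move=> f; apply: (eq_linear_malg (u := project \o @iotabar K X) (v := idfun)).
by move=> [s] /=; rewrite (iotabar_word s) project_placed.
Qed.

End Places.

(** * Graded ideals inside letterplace ideals *)

Section Correspondence.
Context (K : fieldType) (X : countType).
Local Notation Xbar := (option X).
Local Notation Fbar := (freeAlg K Xbar).
Local Notation Var := (Xbar * posn)%type.
Local Notation Mon := {cmonom Var}.
Local Notation Pbar := {malg K[Mon]}.

Section Retract.
Context (S : set Fbar) (idS : is_ideal S).

(** The largest N-ideal that [project] maps into S. *)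
Definition contextual : set Pbar :=
  [set f | forall k p, S (project (p * shift k f))]%classic.

Lemma contextual_Nideal : is_Nideal contextual.
Proof.
split=> [|l f Sf k p]; last by rewrite shift_shift.
apply: malg_ideal => [k p|f g Sf Sg k p|f g Sg k p|f g Sf k p].
- by rewrite linear0 mulr0 linear0; exact: (ideal0 idS).
- rewrite (linearD (@shift K X k)) mulrDr (linearD (@project K X)).
  exact: (idealD idS (Sf k p) (Sg k p)).
- by rewrite shiftM mulrA; exact: Sg.
- by rewrite shiftM [(_ * shift k g)]mulrC mulrA; exact: Sf.
Qed.

(** By [placed_factor] the projection is either 0 or u g v, with the same words
    u and v for all the words of g, since these have a common length. *)
Lemma project_monomial_context d m k g : homogeneous d g -> S g ->
  S (project (<< m >> * shift k (iotabar g))).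
Proof.
move=> hg Sg.
have ->: project (<< m >> * shift k (iotabar g)) =
    \sum_(w <- msupp g) g@_w *: project << (m * placed k w)%M >>.
  rewrite -(linextE (fun w : {fmonom Xbar} =>
    project << (m * placed k w)%M >>)).
  apply: (eq_linear_malg
    (u := @project K X \o (<< m >> \*o (@shift K X k \o @iotabar K X)))).
  move=> [s] /=.
  rewrite (linextU _ (FMonom s)) (iotabar_word K s).
  by rewrite shift_placed addn0 malgU1M.
have [[w0 [z [w0g mz]]]|noz] := pselect (exists w z,
    w \in msupp g /\ (m * placed k (w : {fmonom Xbar}))%M = placed 0 z).
  have [u [v muv]] := placed_factor mz.
  have -> : \sum_(w <- msupp g) g@_w *: project << (m * placed k w)%M >> =
      word K u * g * word K v.
    rewrite [in RHS](monalgE g) mulr_sumr mulr_suml.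
    apply: eq_big_seq => -[w] wg.
    rewrite muv ?project_placed; last by rewrite -!fdegE (hg _ wg) (hg _ w0g).
    by rewrite -malgZU !malgUM mul1r mulr1 /mmul /= !fmmulE /= catA.
  exact: (idealMr idS _ (idealMl idS _ Sg)).
rewrite big_seq big1 => [|w wg]; first exact: (ideal0 idS).
rewrite project_other ?scaler0 // => s sm; apply: noz.
by exists w, s.
Qed.

Lemma contextual_iotabar (grS : forall d f, S f -> S (component d f)) :
  (@iotabar K X @` S `<=` contextual)%classic.
Proof.
move=> _ [g Sg <-] k p; elim/malg_ind: p => [|p q Sp Sq|c m].
- by rewrite mul0r linear0; exact: (ideal0 idS).
- by rewrite mulrDl (linearD (@project K X)); exact: (idealD idS Sp Sq).
rewrite malgZU -scalerAl (linearZ_LR (@project K X)); apply: (idealZ idS).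
have [N gN] := degree_bound g.
rewrite (sum_components gN) (linear_sum (@iotabar K X)).
rewrite (linear_sum (@shift K X k)).
rewrite mulr_sumr (linear_sum (@project K X)); apply: (ideal_sum idS) => d _ /=.
by apply: project_monomial_context (grS _ _ Sg); apply: component_homogeneous.
Qed.

End Retract.

(** Every element of the N-ideal generated by iotabar(S) is contextual;
    evaluate at the trivial context and use that [project] retracts
    [iotabar]. *)
Lemma Nideal_iotabar (S : set Fbar) g :
  is_ideal S -> (forall d f, S f -> S (component d f)) ->
  Nideal_gen (@iotabar K X @` S)%classic (iotabar g) <-> S g.
Proof.
move=> idS grS; split=> [Jg|Sg]; last by apply: sub_gen_smallest; exists g.
have /(_ 0%N 1) :=
  smallest_sub (contextual_Nideal idS) (contextual_iotabar idS grS) Jg.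
have shift0 : shift 0 (iotabar g) = iotabar g.
  apply: (eq_linear_malg (u := @shift K X 0 \o @iotabar K X)
    (v := @iotabar K X)).
  by move=> [s] /=; rewrite (iotabar_word K s) shift_placed.
by rewrite mul1r shift0 iotabarK.
Qed.

End Correspondence.

Section NidealTheory.
Context (K : fieldType) (X : countType).
Local Notation Xbar := (option X).
Local Notation Fbar := (freeAlg K Xbar).
Local Notation Var := (Xbar * posn)%type.
Local Notation Pbar := {malg K[{cmonom Var}]}.
Local Notation T := (gen K (None : Xbar)).
Implicit Types (J : set Pbar) (S : set Fbar).

Lemma Nideal_gen_Nideal (G : set Pbar) : is_Nideal (Nideal_gen G).
Proof.
split=> [|k f Gf J [NJ GJ]]; last by apply: NJ.2; exact: (Gf J (conj NJ GJ)).
apply: malg_ideal => [J [NJ GJ]|f g Gf Gg J [NJ GJ]|f g Gg J [NJ GJ]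
                     |f g Gf J [NJ GJ]].
- exact: (ideal0 NJ.1).
- exact: (idealD NJ.1 (Gf J (conj NJ GJ)) (Gg J (conj NJ GJ))).
- exact: (idealMl NJ.1 _ (Gg J (conj NJ GJ))).
- exact: (idealMr NJ.1 _ (Gf J (conj NJ GJ))).
Qed.

Lemma iotabar_wordM s (g : Fbar) :
  iotabar (word K s * g) = iotabar (word K s) * shift (size s) (iotabar g).
Proof.
have gE := linear_malgE
  (iotabar (word K s) \*o (@shift K X (size s) \o @iotabar K X)) g.
apply: etrans (etrans _ (esym gE)) (erefl _).
rewrite malgM_def fgmulUg (linear_sum (@iotabar K X)).
apply: eq_bigr => -[w] _ /=; rewrite mul1r malgZU.
rewrite (linearZ_LR (@iotabar K X)) (iotabar_word K w) (iotabar_word K s).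
by rewrite shift_placed malgU1M addn0 /mmul /= fmmulE iotabar_word placed_cat.
Qed.

(** Multiplicativity up to a shift: the letters of g are placed behind those
    of f, all of whose words have length d. *)
Lemma iotabarM d (f g : Fbar) : homogeneous d f ->
  iotabar (f * g) = iotabar f * shift d (iotabar g).
Proof.
move=> hf.
have fgE : f * g = \sum_(w <- msupp f) f@_w *: (<< w >> * g).
  rewrite [in LHS](monalgE f) mulr_suml; apply: eq_bigr => w _.
  by rewrite malgZU scalerAl.
rewrite fgE (linear_sum (@iotabar K X)) (linear_malgE (@iotabar K X) f).
rewrite mulr_suml.
apply: eq_big_seq => -[w] wf; rewrite (linearZ_LR (@iotabar K X)) -scalerAl.
by congr (_ *: _); rewrite -(hf _ wf); exact: iotabar_wordM.
Qed.

Lemma letter_iotabar y d :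
  @letter K X y (posnS d) = shift d (iotabar (gen K y)).
Proof.
rewrite gen_word iotabar_word shift_placed addn0 /=.
by rewrite mulm1.
Qed.

(** Translates the total degree, which places the letter t in the saturation
    condition, into the degree of a homogeneous preimage. *)
Lemma tdeg_iotabar d (f : Fbar) :
  homogeneous d f -> f != 0 -> tdeg (iotabar f) = d.
Proof.
move=> hf nzf; have mf m : m \in msupp (iotabar f) -> mdeg m = d.
  apply: contraTeq => md; rewrite -mcoeff_eq0 iotabar_linext linextE mcoeff_sum.
  rewrite big_seq big1 // => w wf; rewrite mcoeffZ mcoeffU.
  case: (placed 0 w =P m) md => [<-|_ _]; last by rewrite mulr0.
  by rewrite mdeg_placed -fdegE (hf _ wf) eqxx.
have : msupp (iotabar f) != fset0.
  rewrite msupp_eq0; apply: contra nzf => /eqP f0.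
  by rewrite -(iotabarK f) f0 linear0.
case/fset0Pn => m msf; rewrite /tdeg; suff -> : msize (iotabar f) = d.+1 by [].
apply/eqP; rewrite eqn_leq -{2}(mf m msf) msize_mdeg_lt // andbT.
by rewrite msizeE; apply/bigmax_leqP_seq => n /mf ->.
Qed.

Lemma Lbar_iotabar d (f : Fbar) : homogeneous d f -> @Lbar K X (iotabar f).
Proof. by move=> hf; exists d => //; exists f. Qed.

(** The homogeneous components of the elements of S have their images in
    Lbar and generate the same N-ideal. *)
Lemma Nideal_Lideal S : (forall d f, S f -> S (component d f)) ->
  is_Lideal (Nideal_gen (@iotabar K X @` S)%classic).
Proof.
move=> grS; have NJ := Nideal_gen_Nideal (@iotabar K X @` S)%classic.
split=> //; apply/seteqP; split; last by apply: smallest_sub => // f [].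
apply: smallest_sub; first exact: Nideal_gen_Nideal.
move=> _ [g Sg <-]; have [N gN] := degree_bound g.
rewrite (sum_components gN) (linear_sum (@iotabar K X)).
set L := Nideal_gen _; have NL : is_Nideal L := Nideal_gen_Nideal _.
apply: (ideal_sum NL.1) => d _; apply: sub_gen_smallest; split.
  by apply: sub_gen_smallest; exists (component d g) => //; apply: grS.
exact: Lbar_iotabar (component_homogeneous d g).
Qed.

End NidealTheory.

(** * Normal forms modulo the commutators with T *)

Lemma commutatorM (R : pzRingType) (g w t : R) :
  t * (g * w) - g * w * t = - ((g * t - t * g) * w) + g * (t * w - w * t).
Proof. by rewrite mulrBl mulrBr opprB !mulrA addrA subrK. Qed.

Lemma commutator_expr (R : pzRingType) (u v t : R) k :
  t * v - u * t ^+ k.+1 = t * (v - u * t ^+ k) + (t * u - u * t) * t ^+ k.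
Proof. by rewrite exprS mulrBr mulrBl !mulrA addrA subrK. Qed.

Section Commutators.
Context (K : fieldType) (X : countType).
Local Notation Xbar := (option X).
Local Notation Fbar := (freeAlg K Xbar).
Local Notation T := (gen K (None : Xbar)).
Context (S : set Fbar) (idS : is_ideal S).
Context (commS : forall x : X, S (gen K (Some x) * T - T * gen K (Some x))).

Lemma word_nseqT k : word K (nseq k (None : Xbar)) = T ^+ k.
Proof.
elim: k => [|k IH]; first by rewrite word_nil.
by rewrite exprS -IH gen_word -word_cat.
Qed.

Lemma commutator_word (u : seq X) :
  S (T * word K (map Some u) - word K (map Some u) * T).
Proof.
elim: u => [|x u IH] /=.
  by rewrite word_nil mulr1 mul1r subrr; exact: (ideal0 idS).
rewrite -cat1s word_cat -gen_word; set g := gen K (Some x).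
set w := word K _ in IH *.
have -> : T * (g * w) - g * w * T =
    - ((g * T - T * g) * w) + g * (T * w - w * T).
  exact: commutatorM.
apply: (idealD idS); first exact: (idealN idS (idealMr idS _ (commS x))).
exact: (idealMl idS _ IH).
Qed.

(** Moving every T of a word s to the right: the normal form is the word
    without T, followed by as many T as were deleted, and it depends only on
    size s and dehom s. *)
Lemma word_normal s :
  S (word K s - homogenize (size s) (dehom (word K s))).
Proof.
rewrite dehom_word homogenize_word word_cat word_nseqT.
elim: s => [|[x|] s IH].
- by rewrite /= word_nil expr0 mulr1 subrr; exact: (ideal0 idS).
- rewrite /= subSS -cat1s -[Some x :: map _ _]cat1s !word_cat -mulrA -mulrBr.
  exact: (idealMl idS _ IH).
rewrite /= -cat1s word_cat -gen_word subSn; last first.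
  by rewrite size_pmap count_size.
set u := word K (map Some _) in IH *; set k := (_ - _)%N in IH *.
have -> : T * word K s - u * T ^+ k.+1 =
    T * (word K s - u * T ^+ k) + (T * u - u * T) * T ^+ k.
  exact: commutator_expr.
apply: (idealD idS); first exact: (idealMl idS _ IH).
exact: (idealMr idS _ (commutator_word _)).
Qed.

(** Hence modulo the commutators a homogeneous element of degree N depends only
    on its dehomogenization. *)
Lemma homogenize_dehom N f : homogeneous N f ->
  S (f - homogenize N (dehom f)).
Proof.
move=> hf.
have uE := linear_malgE (idfun \- (@homogenize K X N \o @dehom K X)) f.
rewrite -[f - _]/((idfun \- (@homogenize K X N \o @dehom K X)) f) uE big_seq.
apply: (ideal_sum idS) => -[w] wf; apply: (idealZ idS) => /=.
by have := word_normal w; rewrite (hf _ wf : size w = N).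
Qed.

End Commutators.

(** * Multiplication by T and the generators of D *)

Section Saturation.
Context (K : fieldType) (X : countType).
Local Notation Xbar := (option X).
Local Notation F := (freeAlg K X).
Local Notation Fbar := (freeAlg K Xbar).
Local Notation Var := (Xbar * posn)%type.
Local Notation Pbar := {malg K[{cmonom Var}]}.
Local Notation T := (gen K (None : Xbar)).

Lemma homogeneous_gen (A : choiceType) (a : A) : homogeneous 1 (gen K a).
Proof. by rewrite gen_word; apply: homogeneous_wordE. Qed.

Lemma homogeneousMT d k (f : Fbar) :
  homogeneous d f -> homogeneous (d + k) (f * T ^+ k).
Proof.
move=> hf; apply: homogeneousM => //; rewrite -word_nseqT.
by apply: homogeneous_wordE; rewrite size_nseq.
Qed.

Lemma dehom_MT k (f : Fbar) : dehom (f * T ^+ k) = dehom f.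
Proof.
elim: k => [|k IH]; first by rewrite mulr1.
by rewrite exprSr mulrA dehomM dehom_gen mulr1.
Qed.

Lemma iotabarMT d (f : Fbar) : homogeneous d f ->
  iotabar (f * T) = letter K None (posnS d) * iotabar f.
Proof. by move=> hf; rewrite (iotabarM _ hf) letter_iotabar mulrC. Qed.

Lemma dehom_commutator (x : X) :
  dehom (gen K (Some x) * T - T * gen K (Some x)) = 0.
Proof.
apply: etrans (dehomB _ _) _.
apply: etrans (congr2 (fun a b => a - b) (dehomM _ _) (dehomM _ _)) _.
by rewrite !dehom_gen mulr1 mul1r subrr.
Qed.

Lemma iotabar_commutator x :
  iotabar (gen K (Some x) * T - T * gen K (Some x)) =
  letter K (Some x) (posnS 0) * letter K None (posnS 1)
    - letter K None (posnS 0) * letter K (Some x) (posnS 1).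
Proof.
have iM (a b : Xbar) : iotabar (gen K a * gen K b) =
    letter K a (posnS 0) * letter K b (posnS 1).
  by rewrite !gen_word -word_cat iotabar_word /= mulm1 -malgU1M.
exact: etrans (iotabarB _ _) (congr2 (fun a b => a - b) (iM _ _) (iM _ _)).
Qed.

End Saturation.

(** * The bijection *)

Section Bijection.
Context (K : fieldType) (X : countType).
Local Notation Xbar := (option X).
Local Notation F := (freeAlg K X).
Local Notation Fbar := (freeAlg K Xbar).
Local Notation Var := (Xbar * posn)%type.
Local Notation Pbar := {malg K[{cmonom Var}]}.
Local Notation T := (gen K (None : Xbar)).
Implicit Types (I : set F) (J : set Pbar).

Lemma homogenization_ideal I : is_ideal I -> is_ideal (homogenization I).
Proof.
by move=> idI; rewrite (homogenizationE idI); apply: dehom_preimage_ideal.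
Qed.

Lemma homogenization_component I : is_ideal I ->
  forall d f, homogenization I f -> homogenization I (component d f).
Proof.
move=> idI d f; rewrite (homogenizationE idI); apply: homogeneously_component.
by rewrite dehom0; exact: (ideal0 idI).
Qed.

Lemma homogenization_homogeneous I d f : is_ideal I -> homogeneous d f ->
  homogenization I f <-> I (dehom f).
Proof.
move=> idI hf; rewrite (homogenizationE idI).
apply: (homogeneously_homogeneous (P := fun f => I (dehom f)) _ hf).
by rewrite dehom0; exact: (ideal0 idI).
Qed.

Lemma letterplace_iotabar I g : is_ideal I ->
  letterplace I (iotabar g) <-> homogenization I g.
Proof.
move=> idI; apply: Nideal_iotabar; first exact: homogenization_ideal.
exact: homogenization_component.
Qed.

(** Membership in J(I) of elements of Lbar is membership in I^*, that is, of
    the dehomogenization in I; and dehom kills the commutators [x, T] and does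
    not see a factor T. *)
Lemma letterplace_Lsaturated I : is_ideal I -> is_Lsaturated (letterplace I).
Proof.
move=> idI; split.
- by apply: Nideal_Lideal; apply: homogenization_component.
- apply: smallest_sub; first exact: Nideal_gen_Nideal.
  move=> _ [x _ <-]; rewrite -iotabar_commutator.
  apply/(letterplace_iotabar _ idI).
  apply/(homogenization_homogeneous (d := 1 + 1) idI).
    apply: homogeneousD; last apply: homogeneousN;
    by apply: homogeneousM; apply: homogeneous_gen.
  by rewrite dehom_commutator; exact: (ideal0 idI).
move=> _ [d _ [g hg <-]]; have [->|nzg] := eqVneq g 0.
  move=> _; apply/(letterplace_iotabar _ idI).
  exact: (ideal0 (homogenization_ideal idI)).
rewrite (tdeg_iotabar hg nzg) -(iotabarMT hg) => /(letterplace_iotabar _ idI).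
have hgT : homogeneous (d + 1) (g * T) by apply: (homogeneousMT (k := 1) hg).
move/(homogenization_homogeneous idI hgT); rewrite (dehom_MT 1 g) => Ig.
exact/(letterplace_iotabar _ idI)/(homogenization_homogeneous idI hg).
Qed.

Lemma letterplace_inj I1 I2 : is_ideal I1 -> is_ideal I2 ->
  letterplace I1 = letterplace I2 -> I1 = I2.
Proof.
move=> id1 id2 I12.
rewrite -(dehom_homogenization id1) -(dehom_homogenization id2).
congr image; apply/seteqP.
split=> g.
  move=> /(letterplace_iotabar g id1); rewrite I12.
  by move=> /(letterplace_iotabar g id2).
move=> /(letterplace_iotabar g id2); rewrite -I12.
by move=> /(letterplace_iotabar g id1).
Qed.

(** Surjectivity: S is the graded ideal of Fbar whose homogeneous elements are
    those mapped into J, and the ideal of F sought is dehom(S). *)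
Section Preimage.
Context (J : set Pbar) (satJ : is_Lsaturated J).

Let NJ : is_Nideal J. Proof. by case: satJ => -[]. Qed.

Let S : set Fbar := homogeneously (fun f => J (iotabar f)).

Let J0 : J (iotabar 0).
Proof. by rewrite linear0; exact: (ideal0 NJ.1). Qed.

Lemma iotabar_preimage_ideal : is_ideal S.
Proof.
apply: (homogeneously_ideal J0) => [f g Jf Jg|d e f g hf hg Jf].
  rewrite (linearD (@iotabar K X)) /=.
  exact: (idealD NJ.1 Jf Jg).
split.
  by rewrite (iotabarM g hf); exact: (idealMr NJ.1 _ Jf).
by rewrite (iotabarM f hg); exact: (idealMl NJ.1 _ (NJ.2 e _ Jf)).
Qed.

Let S_component d f : S f -> S (component d f).
Proof. exact: homogeneously_component. Qed.

Let S_homogeneous d f : homogeneous d f -> S f <-> J (iotabar f).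
Proof. exact: homogeneously_homogeneous. Qed.

Lemma Nideal_iotabar_preimage : Nideal_gen (@iotabar K X @` S)%classic = J.
Proof.
apply/seteqP; split.
  apply: smallest_sub => // _ [g Sg <-]; have [N gN] := degree_bound g.
  rewrite (sum_components gN) (linear_sum (@iotabar K X)).
  by apply: (ideal_sum NJ.1) => d _; exact: (Sg d).
case: satJ => -[_ JE] _ _; rewrite {1}JE.
apply: smallest_sub; first exact: Nideal_gen_Nideal.
move=> f [Jf [d _ [g hg gf]]]; rewrite -gf in Jf *.
apply: sub_gen_smallest; exists g; last exact: erefl.
exact: (S_homogeneous hg).2 Jf.
Qed.

Lemma preimage_commutator x : S (gen K (Some x) * T - T * gen K (Some x)).
Proof.
apply/(S_homogeneous (d := 1 + 1)).
  apply: homogeneousD; last apply: homogeneousN;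
  by apply: homogeneousM; apply: homogeneous_gen.
rewrite iotabar_commutator; case: satJ => _ DJ _; apply: DJ.
by apply: sub_gen_smallest; exists x.
Qed.

Lemma preimage_saturated d k f : homogeneous d f -> S (f * T ^+ k) -> S f.
Proof.
move=> hf; elim: k => [|k IH]; first by rewrite mulr1.
have hfT := homogeneousMT (k := k) hf.
have [fT0 _|nzfT] := eqVneq (f * T ^+ k) 0.
  by apply: IH; rewrite fT0; exact: (ideal0 iotabar_preimage_ideal).
rewrite exprSr mulrA => SfT; apply: IH.
apply/(S_homogeneous hfT); case: satJ => _ _; apply.
  exact: Lbar_iotabar hfT.
rewrite (tdeg_iotabar hfT nzfT) -(iotabarMT hfT).
have hfTT : homogeneous (d + k + 1) (f * T ^+ k * T).
  exact: (homogeneousMT (k := 1) hfT).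
exact/(S_homogeneous hfTT).
Qed.

(** After padding with powers of T to the common degree N, f and h have the
    same normal form modulo the commutators; so f T^(N - d) is in S, and
    saturation cancels the power of T. *)
Lemma dehom_preimage_eq d f h :
  homogeneous d f -> S h -> dehom f = dehom h -> S f.
Proof.
move=> hf Sh fh; have idS := iotabar_preimage_ideal.
have [M hM] := degree_bound h; pose N := maxn d M.
have hN w : w \in msupp h -> (fdeg w <= N)%N.
  by move/hM => wM; apply: leq_trans wM (leq_maxr _ _).
pose h' := \sum_(e < N.+1) component e h * T ^+ (N - e).
have Sh' : S h'.
  by apply: (ideal_sum idS) => e _; exact: (idealMr idS _ (S_component e Sh)).
have homh' : homogeneous N h'.
  apply: homogeneous_sum => e _.
  rewrite -{1}(subnKC (ltn_ord e : (e <= N)%N)); apply: homogeneousMT.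
  exact: component_homogeneous.
have dh' : dehom h' = dehom h.
  rewrite dehom_sum [in RHS](sum_components hN) dehom_sum.
  by apply: eq_bigr => e _; exact: dehom_MT.
have homf' : homogeneous N (f * T ^+ (N - d)).
  have dN : (d + (N - d))%N = N := subnKC (leq_maxl d M).
  by rewrite -[X in homogeneous X]dN; apply: homogeneousMT.
apply: (preimage_saturated (k := N - d) hf).
have normal p := homogenize_dehom (f := p) idS preimage_commutator.
(* Both f T^(N - d) and h' are congruent to [homogenize N (dehom h)]. *)
apply: (ideal_subr idS (normal _ _ homf')).
rewrite dehom_MT fh -dh' -[homogenize _ _](subrK h') -opprB.
exact: (idealD idS (idealN idS (normal _ _ homh')) Sh').
Qed.

(** dehom(S) is an ideal as [dehom] is onto, and its homogenization is S by
    [dehom_preimage_eq]. *)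
Lemma preimage_surj : exists2 I, is_ideal I & letterplace I = J.
Proof.
have idS := iotabar_preimage_ideal.
pose I := (@dehom K X @` S)%classic.
have idI : is_ideal I.
  apply: malg_ideal.
  - by exists 0; [exact: (ideal0 idS)|exact: dehom0].
  - move=> _ _ [f Sf <-] [g Sg <-]; exists (f + g); last exact: dehomD.
    exact: (idealD idS).
  - move=> f _ [g Sg <-]; exists (incl f * g); last by rewrite dehomM inclK.
    exact: (idealMl idS).
  - move=> _ g [f Sf <-]; exists (f * incl g); last by rewrite dehomM inclK.
    exact: (idealMr idS).
exists I => //; rewrite -[RHS]Nideal_iotabar_preimage /letterplace.
congr (Nideal_gen (image _ _)); rewrite (homogenizationE idI).
apply/seteqP; split=> f Sf; last first.
  move=> d; exists (component d f); last exact: erefl.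
  exact: S_component.
have [N fN] := degree_bound f; rewrite (sum_components fN).
apply: (ideal_sum idS) => d _; have [h Sh hf] := Sf d.
exact: (dehom_preimage_eq (component_homogeneous d f) Sh (esym hf)).
Qed.

End Preimage.
End Bijection.

Theorem mainTheorem1 (K : fieldType) (X : countType) :
  set_bij [set I : set (freeAlg K X) | is_ideal I]%classic
          [set J | is_Lsaturated J]%classic
          (@letterplace K X).
Proof.
split=> [I idI|I1 I2|J satJ].
- exact: letterplace_Lsaturated.
- by rewrite !inE; exact: letterplace_inj.
- by have [I idI IJ] := preimage_surj satJ; exists I.
Qed.
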